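(* Let $M$ and $N$ be two quasianalytic weight sequences and assume $\lim_{k\to+\infty}n_k^{1/k}=+\infty$ (i.e. $\mathcal O^{0,r}\subsetneq\mathcal E^{0,r}_{(N)}$). Then $j^\infty(\mathcal E^{0,r}_{\{M\}})\cap\Lambda^r_{(N)}$ is Haar-null in $\Lambda^r_{(N)}$.
   Context: For a sequence $M=(M_p)_{p\in\mathbb N}$ of positive reals write $m_p:=M_p/p!$ (and $n_p:=N_p/p!$). $M$ is a weight sequence if $1=M_0\le M_1$, $M_p^2\le M_{p-1}M_{p+1}$ for all $p\ge1$, and $\liminf_{p\to\infty}m_p^{1/p}>0$; it is quasianalytic if $\sum_{p\ge1}M_{p-1}/M_p=+\infty$. For $U\subseteq\mathbb R^r$ open, $K\subseteq U$ compact, $h>0$: $\|f\|^M_{K,h}:=\sup_{\alpha\in\mathbb N^r,x\in K}|\partial^\alpha f(x)|/(h^{|\alpha|}M_{|\alpha|})$. $\mathcal E_{\{M\}}(U)$ consists of smooth $f$ such that for every compact $K\subseteq U$ there exists $h>0$ with $\|f\|^M_{K,h}<\infty$; $\mathcal E_{(M)}(U)$: for every compact $K$ and every $h>0$. $\mathcal E^{0,r}_{\{M\}}$, $\mathcal E^{0,r}_{(M)}$ are the spaces of germs at $0\in\mathbb R^r$ of functions in the respective class on some cube $(-1/k,1/k)^r$; $\mathcal O^{0,r}$ denotes germs at $0$ of real analytic functions. For $\mathbf b=(b_\alpha)_{\alpha\in\mathbb N^r}$ and $h>0$: $|\mathbf b|^N_h:=\sup_\alpha|b_\alpha|/(h^{|\alpha|}n_{|\alpha|})$;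 $\Lambda^r_{(N)}:=\{\mathbf b:\forall h>0,|\mathbf b|^N_h<\infty\}$, a Fréchet space with the seminorms $|\cdot|^N_h$, $h>0$. The Borel map is $j^\infty(f)=(\partial^\alpha f(0)/|\alpha|!)_{\alpha\in\mathbb N^r}$. In a complete metric vector space $X$, a Borel set $B$ is Haar-null if there is a compactly supported Borel probability measure $\mu$ with $\mu(x+B)=0$ for all $x\in X$; an arbitrary set is Haar-null if it is contained in a Haar-null Borel set. *)

(* Defs.v *)
From HB Require Import structures.
From mathcomp Require Import all_boot all_order all_algebra.
From mathcomp Require Import all_classical all_reals all_analysis.
Set Implicit Arguments. Unset Strict Implicit. Unset Printing Implicit Defensive.
Import Order.TTheory GRing.Theory Num.Theory.
Import numFieldNormedType.Exports.
Local Open Scope classical_set_scope.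
Local Open Scope ring_scope.

Section Defs.
Variable R : realType.

Definition normfact (M : nat -> R) (p : nat) : R := M p / (p`!)%:R.

Definition weight_sequence (M : nat -> R) : Prop :=
  (forall p, 0 < M p) /\ M 0%N = 1 /\ 1 <= M 1%N /\
  (forall p, (1 <= p)%N -> M p ^+ 2 <= M p.-1 * M p.+1) /\
  (0 < limn_einf (fun p => ((normfact M p) `^ (p%:R^-1))%:E))%E.

Definition quasianalytic (M : nat -> R) : Prop :=
  (fun n => \sum_(1 <= p < n) M p.-1 / M p) @ \oo --> +oo.

Definition mindex (r : nat) := {ffun 'I_r -> nat}.
Definition mlen (r : nat) (a : mindex r) : nat := \sum_(i < r) a i.

Definition evec (r : nat) (i : 'I_r) : 'rV[R]_r := delta_mx 0 i.

Fixpoint pderiv_seq (r : nat) (s : seq 'I_r) (f : 'rV[R]_r -> R) : 'rV[R]_r -> R :=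
  match s with
  | [::] => f
  | i :: s' => fun x => derive (pderiv_seq s' f) x (evec i)
  end.

Definition pderiv (r : nat) (a : mindex r) (f : 'rV[R]_r -> R) : 'rV[R]_r -> R :=
  pderiv_seq (flatten [seq nseq (a i) i | i <- enum 'I_r]) f.

Definition smooth_on (r : nat) (U : set 'rV[R]_r) (f : 'rV[R]_r -> R) : Prop :=
  forall (s : seq 'I_r) (x : 'rV[R]_r), U x ->
    {for x, continuous (pderiv_seq s f)} /\
    (forall i, derivable (pderiv_seq s f) x (evec i)).

Definition roumieu (r : nat) (M : nat -> R) (U : set 'rV[R]_r) (f : 'rV[R]_r -> R) : Prop :=
  smooth_on U f /\
  forall K : set 'rV[R]_r, compact K -> K `<=` U ->
    exists h : R, 0 < h /\ exists C : R, forall (a : mindex r) x, K x ->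
      `|pderiv a f x| <= C * (h ^+ mlen a * M (mlen a)).

Definition cube (r : nat) (k : nat) : set 'rV[R]_r :=
  [set x | forall i, `|x 0 i| < k%:R^-1].

Definition borel_map (r : nat) (f : 'rV[R]_r -> R) : mindex r -> R :=
  fun a => pderiv a f 0 / ((mlen a)`!)%:R.

(* j^infty(E^{0,r}_{M}) : jets at 0 of germs of E_{M} functions on some cube *)
Definition jets_roumieu (r : nat) (M : nat -> R) : set (mindex r -> R) :=
  [set b | exists k : nat, (0 < k)%N /\
     exists f, roumieu M (@cube r k) f /\ b = borel_map f].

Definition Lambda (r : nat) (N : nat -> R) : set (mindex r -> R) :=
  [set b | forall h : R, 0 < h -> exists C : R, forall a : mindex r,
     `|b a| <= C * (h ^+ mlen a * normfact N (mlen a))].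

Definition Lball (r : nat) (N : nat -> R) (b : mindex r -> R) (h e : R) :=
  [set c | Lambda N c /\ forall a : mindex r,
     `|c a - b a| <= e * (h ^+ mlen a * normfact N (mlen a))].

(* open sets of the Frechet topology of Lambda^r_(N) (given by the seminorms) *)
Definition Lopen (r : nat) (N : nat -> R) (U : set (mindex r -> R)) : Prop :=
  U `<=` Lambda N /\ forall b, U b -> exists h e : R, 0 < h /\ 0 < e /\ Lball N b h e `<=` U.

Definition Lborel (r : nat) (N : nat -> R) : set (set (mindex r -> R)) :=
  <<s Lambda N, Lopen N >>.

Definition Lcompact (r : nat) (N : nat -> R) (K : set (mindex r -> R)) : Prop :=
  K `<=` Lambda N /\
  forall F : set (set (mindex r -> R)), F `<=` Lopen N -> K `<=` \bigcup_(A in F) A ->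
    exists G, finite_set G /\ G `<=` F /\ K `<=` \bigcup_(A in G) A.

(* Borel probability measure on Lambda^r_(N) (values off the Borel sets are irrelevant) *)
Definition Lprob (r : nat) (N : nat -> R) (mu : set (mindex r -> R) -> R) : Prop :=
  (forall A, Lborel N A -> 0 <= mu A) /\ mu (Lambda N) = 1 /\
  (forall F : nat -> set (mindex r -> R), (forall n, Lborel N (F n)) ->
     trivIset setT F -> series (fun n => mu (F n)) @ \oo --> mu (\bigcup_n F n)).

Definition Lcompact_support (r : nat) (N : nat -> R) (mu : set (mindex r -> R) -> R) : Prop :=
  exists K, Lcompact N K /\ Lborel N K /\ mu K = 1.

Definition translate (r : nat) (x : mindex r -> R) (B : set (mindex r -> R)) :=
  [set (fun a => x a + c a) | c in B].

Definition Lhaar_null (r : nat) (N : nat -> R) (A : set (mindex r -> R)) : Prop :=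
  exists B, Lborel N B /\ A `<=` B /\
    exists mu, Lprob N mu /\ Lcompact_support N mu /\
      forall x, Lambda N x -> mu (translate x B) = 0.

End Defs.

(* Main.v *)
Require Import Defs.
From HB Require Import structures.
From mathcomp Require Import all_boot all_order all_algebra finmap.
From mathcomp Require Import all_classical all_reals all_analysis.
From mathcomp Require Import ring lra.
Set Implicit Arguments. Unset Strict Implicit. Unset Printing Implicit Defensive.
Import Order.TTheory GRing.Theory Num.Theory.
Import numFieldNormedType.Exports.
Local Open Scope classical_set_scope.
Local Open Scope ring_scope.

(** The jet [c] with entries [sqrt n_|a|] lies in [Lambda N], has positive
    entries, and grows faster than any geometric sequence. By a theorem of Bang, a
    function in a quasianalytic class whose derivatives at [0] are all positive is
    absolutely monotone on a right neighbourhood of [0], so its Taylor coefficients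
    grow at most geometrically; hence no nonzero multiple of [c] is a jet. The jets
    being closed under differences, each translate meets the line through [c] at
    most once, and Lebesgue measure on the segment [[0, 1] c] witnesses Haar
    nullity. To have a Borel set, the jets are replaced by the limits, order by order
    at [0], of jets of functions obeying a common bound; this forces a finite, quantitative
    form of Bang's theorem. *)

(** * Bang's theorem for towers of derivatives on an interval *)

Section Bang.
Variable R : realType.
Implicit Types (f df : R -> R) (a t s : R) (phi : nat -> R -> R) (L M : nat -> R).

Lemma is_derive_within_continuous f df y z :
  (forall t, y <= t <= z -> is_derive t 1 f (df t)) ->
  {within `[y, z], continuous f}.
Proof.
move=> fdf; apply: derivable_within_continuous => t.
by rewrite in_itv /= => /fdf[].
Qed.

Lemma is_derive_ge0_le f df y z : y <= z ->
  (forall t, y <= t <= z -> is_derive t 1 f (df t)) ->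
  (forall t, y <= t <= z -> 0 <= df t) -> f y <= f z.
Proof.
move=> yz fdf df0.
have [|c + E] := @MVT_segment R f df y z yz _ (is_derive_within_continuous fdf).
  by move=> t; rewrite in_itv /= => /andP[/ltW yt /ltW tz]; apply: fdf; rewrite yt.
rewrite in_itv /= => /df0 dc; rewrite -subr_ge0 E mulr_ge0 // subr_ge0 //.
Qed.

(** A Gronwall-type comparison: for [E t = D * expR (lam * (t - x))], the bound on [df] makes
    [E + f] and [E - f] nondecreasing on [[y, z]]. *)
Lemma exp_majorant f df (D lam x y z : R) : y <= z ->
  (forall t, y <= t <= z -> is_derive t 1 f (df t)) ->
  (forall t, y <= t <= z -> `|df t| <= D * lam * expR (lam * (t - x))) ->
  `|f y| <= D * expR (lam * (y - x)) -> `|f z| <= D * expR (lam * (z - x)).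
Proof.
move=> yz fdf dfle fy.
pose E t : R := D * expR (lam * (t - x)).
have dE t : is_derive t 1 E (D * lam * expR (lam * (t - x))).
  have dl : is_derive t 1 (fun t : R => lam * (t - x)) lam.
    rewrite (_ : (fun _ => _) = lam \*: (id \- cst x)) //.
    by apply: is_derive_eq; rewrite subr0 /GRing.scale /= mulr1.
  rewrite (_ : E = D \*: (expR \o (fun t : R => lam * (t - x)))) //.
  by apply: is_derive_eq; rewrite /GRing.scale /=; ring.
move: fy; rewrite !ler_norml => /andP[fy1 fy2]; apply/andP; split.
- suff : E y + f y <= E z + f z by rewrite /E; lra.
  apply: (@is_derive_ge0_le (E \+ f)
      (fun t => D * lam * expR (lam * (t - x)) + df t) y z yz) => t tyz.
    exact: (is_deriveD (dE t) (fdf t tyz)).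
  by move: (dfle t tyz); rewrite ler_norml; lra.
- suff : E y - f y <= E z - f z by rewrite /E; lra.
  apply: (@is_derive_ge0_le (E \- f)
      (fun t => D * lam * expR (lam * (t - x)) - df t) y z yz) => t tyz.
    exact: (is_deriveB (dE t) (fdf t tyz)).
  by move: (dfle t tyz); rewrite ler_norml; lra.
Qed.

Definition derivative_tower a phi :=
  forall p t, 0 <= t <= a -> is_derive t 1 (phi p) (phi p.+1 t).

(** This form of the growth condition survives index shifts and geometric factors, which the
    normalisation [M 0 = 1] does not. *)
Definition log_convex L :=
  (forall p, 0 < L p) /\ forall p, L p.+1 ^+ 2 <= L p * L p.+2.

Lemma log_convex_ratio L l k : log_convex L -> (l <= k)%N ->
  L l.+1 / L l <= L k.+1 / L k.
Proof.
move=> [L0 Lc]; elim: k => [|k IH]; first by rewrite leqn0 => /eqP->.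
rewrite leq_eqVlt => /orP[/eqP-> //|]; rewrite ltnS => /IH /le_trans; apply.
rewrite ler_pdivrMr // mulrAC ler_pdivlMr // -expr2 mulrC; exact: Lc.
Qed.

Lemma log_convex_shift L j : log_convex L -> log_convex (fun p => L (j + p)%N).
Proof. by move=> [L0 Lc]; split=> p //; rewrite !addnS. Qed.

(** A block of the quasianalyticity series with terms [L i / L i.+1], divided by [e]. *)
Definition bang_length L (k m : nat) : R :=
  \sum_(k <= i < m) (expR 1 * (L i.+1 / L i))^-1.

(* The maximum of [|phi l| / (e ^ l L l)] over the orders [l] with [x l <= s]
   needs a path of length [L k / (e L k.+1)] to grow from [e ^ - k.+1] to
   [e ^ - k]: below that level only the orders [l <= k.+1] matter, and there it
   grows at most like [exp (e L k.+1 / L k s)]. *)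
Lemma bang_growth L a phi (x : nat -> R) (m : nat) :
  log_convex L -> derivative_tower a phi ->
  (forall l, (l < m)%N -> x l.+1 <= x l) ->
  (forall l, (l <= m)%N -> 0 <= x l <= a) ->
  (forall l, (l <= m)%N -> `|phi l (x l)| <= expR (l%:R - m%:R) * L l) ->
  (forall l t, 0 <= t <= a -> `|phi l t| <= L l) ->
  forall k s, (k <= m)%N -> 0 <= s <= a -> s <= bang_length L k m ->
  forall l, (l <= m)%N -> x l <= s -> `|phi l s| <= expR (l%:R - k%:R) * L l.
Proof.
move=> lcL tow xdec xa xstart bnd.
have L0 p : 0 < L p by case: lcL.
suff : forall d k s, (k + d)%N = m -> 0 <= s <= a -> s <= bang_length L k m ->
    forall l, (l <= m)%N -> x l <= s -> `|phi l s| <= expR (l%:R - k%:R) * L l.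
  by move=> H k s km; apply: (H (m - k)%N); rewrite subnKC.
elim=> [|d IH] k s.
  rewrite addn0 => -> /andP[s0 _]; rewrite /bang_length big_geq // => sle l lm xls.
  have /eqP s_eq : s == 0 by rewrite eq_le s0 sle.
  have /eqP x_eq : x l == s.
    by rewrite eq_le xls s_eq; case/andP: (xa l lm).
  by rewrite -x_eq; apply: xstart.
rewrite addnS -addSn => kdm s0a.
have km : (k < m)%N by rewrite -kdm leq_addr.
set lam := expR 1 * (L k.+1 / L k).
have lam0 : 0 < lam by rewrite mulr_gt0 ?expR_gt0 // divr_gt0.
rewrite /bang_length big_ltn // -/(bang_length L k.+1 m) -/lam.
set y := bang_length L k.+1 m => sle l lm xls.
have y0 : 0 <= y.
  apply: sumr_ge0 => i _; rewrite invr_ge0 mulr_ge0 ?expR_ge0 // ltW //.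
  by rewrite divr_gt0.
(* For [l > k] the exponential factor is at least 1 and the global bound suffices. *)
have [kl|lk] := ltnP k l.
  apply: le_trans (bnd _ _ s0a) _; rewrite ler_peMl ?(ltW (L0 _)) //.
  by rewrite -[leLHS]expR0 ler_expR subr_ge0 ler_nat ltnW.
have [sy|ys] := leP s y.
  apply: le_trans (IH k.+1 s kdm s0a sy l lm xls) _.
  by rewrite ler_pM2r // ler_expR lerD2l lerN2 ler_nat.
have ya : 0 <= y <= a by rewrite y0 /=; move: s0a => /andP[_]; apply/le_trans/ltW.
(* Descending induction on the order [i], from the global bound at [k.+1]: log-convexity bounds
   [L i.+1 / L i] by [L k.+1 / L k], so every order grows at rate at most [lam]. *)
have main : forall j i t, (i + j)%N = k.+1 -> y <= t <= a -> x i <= t ->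
    `|phi i t| <= expR (i%:R - k.+1%:R) * L i * expR (lam * (t - y)).
  elim=> [|j IHj] i t.
    rewrite addn0 => -> /andP[yt ta] _; rewrite subrr expR0 mul1r.
    apply: le_trans (bnd _ _ _) _; first by rewrite (le_trans y0 yt).
    by rewrite ler_peMr ?(ltW (L0 _)) // -[leLHS]expR0 ler_expR mulr_ge0 ?subr_ge0 // ltW.
  rewrite addnS -addSn => ijk /andP[yt ta] xit.
  have ik : (i <= k)%N by rewrite -ltnS -ijk leq_addr.
  have im : (i < m)%N by rewrite (leq_ltn_trans ik).
  have /andP[xi0 xia] := xa i (ltnW im).
  have mxt : Num.max y (x i) <= t by rewrite ge_max yt.
  have [ym xm] : y <= Num.max y (x i) /\ x i <= Num.max y (x i).
    by rewrite !le_max !lexx orbT.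
  apply: (exp_majorant (df := phi i.+1) mxt).
  - move=> u /andP[mu ut]; apply: tow.
    by rewrite (le_trans y0) ?(le_trans ym) //= (le_trans ut).
  - move=> u /andP[mu ut].
    have yu : y <= u <= a by rewrite (le_trans ym) // (le_trans ut).
    have xu : x i.+1 <= u by rewrite (le_trans (xdec _ im)) // (le_trans xm).
    apply: le_trans (IHj i.+1 u ijk yu xu) _.
    rewrite ler_pM2r ?expR_gt0 // -natr1 addrAC expRD -!mulrA ler_pM2l ?expR_gt0 //.
    rewrite /lam mulrCA ler_pM2l ?expR_gt0 // -ler_pdivrMl // mulrC.
    exact: log_convex_ratio.
  (* The comparison starts at the later of [y] and [x i]: at [x i] the starting bound applies, at
     [y] the induction hypothesis for [k.+1]. *)
  - have [yx|xy] := leP y (x i).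
      apply: le_trans (xstart i (ltnW im)) _.
      apply: (@le_trans _ _ (expR (i%:R - k.+1%:R) * L i)).
        by rewrite ler_pM2r // ler_expR lerD2l lerN2 ler_nat.
      rewrite ler_peMr ?mulr_ge0 ?expR_ge0 ?(ltW (L0 _)) //.
      by rewrite -[leLHS]expR0 ler_expR mulr_ge0 ?subr_ge0 // ltW.
    rewrite subrr mulr0 expR0 mulr1.
    by apply: IH => //; [exact: ltnW|exact: ltW].
have ysa : y <= s <= a by rewrite ltW //=; case/andP: s0a.
have lkE : (l + (k.+1 - l))%N = k.+1 by rewrite subnKC // leqW.
apply: le_trans (main _ l s lkE ysa xls) _.
rewrite mulrAC -expRD ler_pM2r // ler_expR -natr1.
(* The path from [y] to [s] is no longer than the summand [lam^-1], so at most one factor [e] is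
   lost. *)
have : lam * (s - y) <= 1 by rewrite mulrC -ler_pdivlMr // div1r; lra.
lra.
Qed.

(** Quasianalyticity as divergence of every tail, again stable under shifts and geometric
    factors. *)
Definition bang_divergent L :=
  forall k a, exists2 m, (k <= m)%N & a <= bang_length L k m.

Lemma quasianalytic_bang_divergent M : quasianalytic M -> bang_divergent M.
Proof.
move=> + k a => /cvgryPge /(_ (expR 1 * a + \sum_(1 <= p < k.+1) M p.-1 / M p)).
move=> [n _ /(_ (maxn n k).+1)] /=.
rewrite leqW ?leq_maxl // => /(_ isT) H; exists (maxn n k); first exact: leq_maxr.
move: H; rewrite (@big_cat_nat _ _ _ k.+1 1 (maxn n k).+1) //=; last first.
  by rewrite ltnS leq_maxr.
rewrite [leLHS]addrC lerD2l big_add1 /= => H.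
rewrite -(ler_pM2l (expR_gt0 1)); apply: le_trans H _.
rewrite /bang_length mulr_sumr ler_sum // => i _.
by rewrite invfM mulrA divff ?gt_eqF ?expR_gt0 // mul1r invf_div.
Qed.

Lemma is_derive_zero f df a : 0 <= a ->
  (forall t, 0 <= t <= a -> is_derive t 1 f (df t)) ->
  0 <= f 0 -> f a <= 0 -> exists2 c, 0 <= c <= a & f c = 0.
Proof.
move=> a0 fdf f0 fa.
have [|c + fc] := IVT a0 (is_derive_within_continuous fdf) (v := 0).
  by rewrite ge_min le_max f0 fa orbT.
by rewrite in_itv; exists c.
Qed.

(** Between [0] and a zero [x0], [phi 0] falls from a positive value, so [phi 1] is nonpositive at
    some [c < x0]; as [phi 1] is positive at [0], the argument repeats on [[0, c]]. *)
Lemma chain_of_zeros m : forall phi a, 0 <= a -> derivative_tower a phi ->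
  (forall p, (p <= m)%N -> 0 < phi p 0) -> phi 0%N a <= 0 ->
  exists x : nat -> R, [/\ forall l, (l < m)%N -> x l.+1 <= x l,
    forall l, (l <= m)%N -> 0 <= x l <= a & forall l, (l <= m)%N -> phi l (x l) = 0].
Proof.
elim: m => [|m IH] phi a a0 tow pos phia.
all: have [x0 /andP[x00 x0a] phix0] :=
  is_derive_zero a0 (fun t => tow 0%N t) (ltW (pos 0%N isT)) phia.
  by exists (fun=> x0); split=> // l; rewrite ?leqn0 ?x00 // => /eqP->.
have phi00 := pos 0%N isT.
have x0gt : 0 < x0.
  by rewrite lt_neqAle x00 andbT; apply/eqP => E; move: phix0 phi00; rewrite -E => ->; rewrite ltxx.
have towx t : 0 <= t <= x0 -> is_derive t 1 (phi 0%N) (phi 1%N t).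
  by move=> /andP[t0 tx]; apply: tow; rewrite t0 (le_trans tx).
have [|c + E] := @MVT R _ (phi 1%N) 0 x0 x0gt _ (is_derive_within_continuous towx).
  by move=> t; rewrite in_itv /= => /andP[/ltW t0 /ltW tx]; apply: towx; rewrite t0.
rewrite in_itv /= => /andP[c0 cx].
have phic : phi 1%N c <= 0.
  by rewrite leNgt; apply/negP => H; have := mulr_gt0 H x0gt; rewrite subr0 in E; lra.
have [||x [xd xa xz]] := IH (fun p => phi p.+1) c (ltW c0) _ _ phic.
- by move=> p t /andP[t0 tc]; apply: tow; rewrite t0 (le_trans tc) // (le_trans (ltW cx)).
- by move=> p pm; apply: pos.
exists (fun l => if l is l'.+1 then x l' else x0); split=> [[|l]|[|l]|[|l]] //=.
- by move=> _; have /andP[_ /le_trans] := xa 0%N isT; apply; apply: ltW.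
- exact: xd.
- by rewrite x00.
- move=> lm; have /andP[-> /le_trans] := xa l lm; apply.
  by rewrite (le_trans (ltW cx)).
- exact: xz.
Qed.

(** Lets [bang_growth], which propagates bounds to the right, run back from a zero to the origin. *)
Lemma derivative_tower_reflect a phi : derivative_tower a phi ->
  derivative_tower a (fun l t => (-1) ^+ l * phi l (a - t)).
Proof.
move=> tow p t ta.
have dB : is_derive t 1 (fun t : R => a - t) (-1).
  rewrite (_ : (fun _ => _) = cst a \- id) //.
  by apply: is_derive_eq; rewrite sub0r.
have dp : is_derive (a - t) 1 (phi p) (phi p.+1 (a - t)) by apply: tow; lra.
rewrite (_ : (fun _ => _) = (-1) ^+ p \*: (phi p \o (fun t : R => a - t))) //.
by apply: is_derive_eq; rewrite /GRing.scale /= exprS; ring.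
Qed.

(* A zero of [phi 0] on [0, a] would propagate by Rolle to a decreasing chain of
   zeros of the higher derivatives; [bang_growth] along this chain and then
   back to the origin makes [phi 0 0] too small. *)
Lemma bang_positivity L a (v : R) : 0 <= a -> 0 < v -> log_convex L ->
  bang_divergent L ->
  exists m, forall phi, derivative_tower a phi ->
    (forall l t, 0 <= t <= a -> `|phi l t| <= L l) ->
    v <= phi 0%N 0 -> (forall p, (p <= m)%N -> 0 < phi p 0) ->
    forall t, 0 <= t <= a -> 0 < phi 0%N t.
Proof.
move=> a0 v0 lcL divL.
have L0 p : 0 < L p by case: lcL.
(* At level [k] the bound on [phi 0 0] contradicts [v <= phi 0 0]. *)
have [k kv] : exists k : nat, expR (- k%:R) * L 0%N < v.
  have q0 : 0 < L 0%N / v by rewrite divr_gt0.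
  exists (Num.trunc (L 0%N / v)).+1.
  rewrite expRN mulrC ltr_pdivrMr ?expR_gt0 // -ltr_pdivrMl // mulrC.
  apply: lt_le_trans (truncnS_gt _) _.
  by apply: le_trans (expR_ge1Dx _); rewrite lerDr.
(* Two successive blocks of length at least [a]: levels [m] to [k0] pay for the way along the zeros,
   levels [k0] to [k] for the way back. *)
have [k0 kk0 ak0] := divL k a.
have [m k0m am] := divL k0 a.
exists m => phi tow bnd vphi pos t /andP[t0 ta].
rewrite ltNge; apply/negP => phit.
have towt : derivative_tower t phi.
  by move=> p u /andP[u0 ut]; apply: tow; rewrite u0 (le_trans ut).
have [x [xd xt xz]] := chain_of_zeros t0 towt pos phit.
have xle l : (l <= m)%N -> x l <= x 0%N.
  by elim: l => // l IH lm; apply: le_trans (xd _ lm) (IH (ltnW lm)).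
have /andP[x00 x0t] := xt 0%N isT.
have x0a := le_trans x0t ta.
set z := x 0%N in xle x00 x0t x0a.
have leg1 l : (l <= m)%N -> `|phi l z| <= expR (l%:R - k0%:R) * L l.
  move=> lm; apply: (bang_growth (x := x) (m := m) (a := a)) => //.
  - by move=> i /xt/andP[-> /le_trans]; apply.
  - by move=> i im; rewrite xz // normr0 mulr_ge0 ?expR_ge0 // ltW.
  - by rewrite x00.
  - exact: le_trans am.
  - exact: xle.
have towz : derivative_tower z phi.
  by move=> p u /andP[u0 ut]; apply: tow; rewrite u0 (le_trans ut).
have := @bang_growth L z _ (fun=> 0) k0 lcL (derivative_tower_reflect towz).
have nE l u : `|(-1) ^+ l * phi l (z - u)| = `|phi l (z - u)|.
  by rewrite normrM normrX normrN1 expr1n mul1r.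
move=> /(_ (fun _ _ => lexx _)) /= H.
have := H _ _ _ k z kk0 _ (le_trans x0a ak0) 0%N isT x00.
rewrite subrr expr0 mul1r sub0r => {}H.
have : `|phi 0%N 0| <= expR (- k%:R) * L 0%N.
  apply: H.
  - by rewrite lexx x00.
  - by move=> l lk0; rewrite nE subr0; apply: leg1; apply: leq_trans k0m.
  - by move=> l u /andP[u0 uz]; rewrite nE; apply: bnd; lra.
  - by rewrite x00 lexx.
rewrite ger0_norm ?(le_trans (ltW v0)) // => H2.
lra.
Qed.

(** One Taylor term is a lower bound: [phi q] is at least [phi q 0], and integrating down to order 0
    only drops nonnegative initial values. *)
Lemma tower_taylor_le a phi q : 0 <= a -> derivative_tower a phi ->
  (forall p t, (p <= q.+1)%N -> 0 <= t <= a -> 0 <= phi p t) ->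
  phi q 0 * a ^+ q / q`!%:R <= phi 0%N a.
Proof.
move=> a0 tow pos.
suff H : forall j p t, (p + j)%N = q -> 0 <= t <= a ->
    phi q 0 * (t ^+ j / j`!%:R) <= phi p t.
  by rewrite -mulrA; apply: (H q 0%N); rewrite ?add0n // a0 lexx.
elim=> [|j IH] p t.
  rewrite addn0 => -> /andP[t0 ta]; rewrite expr0 fact0 divr1 mulr1.
  apply: (is_derive_ge0_le (df := phi q.+1) t0) => u /andP[u0 ut].
    by apply: tow; rewrite u0 (le_trans ut).
  by apply: pos; rewrite // u0 (le_trans ut).
rewrite addnS -addSn => pjq /andP[t0 ta].
pose g (u : R) := phi p u - phi q 0 * (u ^+ j.+1 / j.+1`!%:R).
suff : g 0 <= g t.
  rewrite /g expr0n /= mul0r mulr0 subr0 => H.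
  rewrite -subr_ge0; apply: le_trans H; apply: pos; last by rewrite lexx.
  by rewrite -pjq addSn leqW // ltnW // ltnS leq_addr.
apply: (is_derive_ge0_le (df := fun u => phi p.+1 u - phi q 0 * (u ^+ j / j`!%:R)) t0)
    => u /andP[u0 ut].
  have dp : is_derive u 1 (phi p) (phi p.+1 u).
    by apply: tow; rewrite u0 (le_trans ut).
  have dX : is_derive u 1 (fun u : R => u ^+ j.+1) (j.+1%:R * u ^+ j).
    rewrite (_ : (fun _ => _) = id ^+ j.+1); last by apply/funext => w; rewrite exprfctE.
    by apply: is_derive_eq; rewrite /GRing.scale /= mulr1 mulr_natl.
  rewrite (_ : g = phi p \- ((phi q 0 / j.+1`!%:R) \*: (fun u : R => u ^+ j.+1))); last first.
    by apply/funext => w; rewrite /g /= /GRing.scale /=; ring.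
  apply: is_derive_eq.
  rewrite /GRing.scale /= factS natrM.
  have j0 : j`!%:R != 0 :> R by rewrite pnatr_eq0 -lt0n fact_gt0.
  by congr (_ - _); field; rewrite j0 nat1r pnatr_eq0.
by rewrite subr_ge0; apply: IH => //; rewrite u0 (le_trans ut).
Qed.

Lemma bang_divergent_shift L j : bang_divergent L ->
  bang_divergent (fun p => L (j + p)%N).
Proof.
move=> divL k a; have [m jkm am] := divL (j + k)%N a.
exists (m - j)%N; first by rewrite leq_subRL // (leq_trans (leq_addr _ _) jkm).
apply: le_trans am _; rewrite /bang_length addnC big_addn.
by under eq_bigr => i _ do rewrite -addSn !(addnC _ j).
Qed.

Lemma log_convex_geometric M Q : 0 < Q -> log_convex M ->
  log_convex (fun p => Q ^+ p.+1 * M p).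
Proof.
move=> Q0 [M0 Mc]; split=> p; first by rewrite mulr_gt0 // exprn_gt0.
have -> : Q ^+ p.+1 * M p * (Q ^+ p.+3 * M p.+2) = (Q ^+ p.+2) ^+ 2 * (M p * M p.+2).
  by rewrite !exprS; ring.
by rewrite exprMn ler_pM2l ?exprn_gt0.
Qed.

Lemma bang_divergent_geometric M Q : 0 < Q -> bang_divergent M ->
  bang_divergent (fun p => Q ^+ p.+1 * M p).
Proof.
move=> Q0 divM k a; have [m km am] := divM k (Q * a).
exists m => //; rewrite -(ler_pM2l Q0); apply: le_trans am _.
rewrite /bang_length mulr_sumr ler_sum // => i _.
have Qn : Q != 0 by rewrite gt_eqF.
have -> : Q ^+ i.+2 * M i.+1 / (Q ^+ i.+1 * M i) = Q * (M i.+1 / M i).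
  by rewrite invfM exprS -!mulrA; congr (_ * _); rewrite mulrCA mulVKf ?expf_neq0.
by rewrite (mulrCA (expR 1) Q) (invfM Q) mulVKf.
Qed.

(** Apply [bang_positivity] to each shifted tower and take the largest [m]. Lower bounds [v] fixed
    in advance keep [m] independent of [phi]. *)
Lemma bang_positivity_upto L a (v : nat -> R) J : 0 <= a ->
  (forall p, 0 < v p) -> log_convex L -> bang_divergent L ->
  exists m, forall phi, derivative_tower a phi ->
    (forall l t, 0 <= t <= a -> `|phi l t| <= L l) ->
    (forall p, (p <= m)%N -> v p <= phi p 0) ->
    forall j t, (j <= J)%N -> 0 <= t <= a -> 0 < phi j t.
Proof.
move=> a0 v0 lcL divL.
have step j : exists m, forall phi, derivative_tower a phi ->
    (forall l t, 0 <= t <= a -> `|phi l t| <= L l) ->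
    (forall p, (p <= m)%N -> v p <= phi p 0) ->
    forall t, 0 <= t <= a -> 0 < phi j t.
  have [m Hm] := bang_positivity a0 (v0 j) (log_convex_shift j lcL)
                   (bang_divergent_shift j divL).
  exists (j + m)%N => phi tow bnd vphi t ta; rewrite -[j]addn0.
  apply: (Hm (fun p => phi (j + p)%N)) => //.
  - by move=> p u ua; rewrite addnS; apply: tow.
  - by move=> l u ua; apply: bnd.
  - by rewrite addn0; apply: vphi; apply: leq_addr.
  - by move=> p pm; apply: lt_le_trans (v0 (j + p)%N) _; apply: vphi; rewrite leq_add2l.
elim: J => [|J [m IH]].
  have [m Hm] := step 0%N; exists m => phi tow bnd vphi j t.
  by rewrite leqn0 => /eqP->; apply: Hm.
have [m' Hm'] := step J.+1; exists (maxn m m') => phi tow bnd vphi j t.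
rewrite leq_eqVlt => /orP[/eqP->|].
  by apply: Hm' => // p pm; apply: vphi; rewrite leq_max pm orbT.
by rewrite ltnS; apply: IH => // p pm; apply: vphi; rewrite leq_max pm.
Qed.

(** One integer controls the interval, the geometric rate and the constant, so that a countable
    union over [q] covers all jets. *)
Definition jet_tower M (q : nat) phi :=
  derivative_tower q.+1%:R^-1 phi /\
  forall l t, 0 <= t <= q.+1%:R^-1 -> `|phi l t| <= q.+1%:R ^+ l.+1 * M l.

Lemma jet_towerB M q1 q2 phi1 phi2 : (forall p, 0 < M p) ->
  jet_tower M q1 phi1 -> jet_tower M q2 phi2 ->
  jet_tower M (q1 + q2).+1 (fun l t => phi1 l t - phi2 l t).
Proof.
move=> M0 [tow1 bnd1] [tow2 bnd2].
have sub t : 0 <= t <= (q1 + q2).+2%:R^-1 ->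
    0 <= t <= q1.+1%:R^-1 /\ 0 <= t <= q2.+1%:R^-1.
  move=> /andP[-> /le_trans H]; split; apply: H; rewrite lef_pV2 ?posrE ?ltr0n //.
    by rewrite ler_nat ltnS -addnS leq_addr.
  by rewrite ler_nat ltnS -addSn leq_addl.
have QE : (q1 + q2).+2%:R = q1.+1%:R + q2.+1%:R :> R by rewrite -natrD addnS addSn.
split=> [p t /sub[t1 t2]|l t /sub[t1 t2]].
  exact: (is_deriveB (tow1 p t t1) (tow2 p t t2)).
apply: le_trans (ler_normB _ _) _.
(* With [x] and [y] the two rates, [x ^+ l.+1 + y ^+ l.+1 <= (x + y) ^+ l.+1]. *)
apply: le_trans (lerD (bnd1 l t t1) (bnd2 l t t2)) _.
rewrite -mulrDl ler_pM2r // QE.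
have: 0 < q1.+1%:R :> R by []; have: 0 < q2.+1%:R :> R by [].
move: q1.+1%:R q2.+1%:R => x y y0 x0.
rewrite [leRHS]exprS mulrDl !(exprS _ l).
by apply: lerD; rewrite ler_pM2l // lerXn2r ?nnegrE ?addr_ge0 ?lerDl ?lerDr ?ltW.
Qed.

Lemma finite_lower_bound (w : nat -> R) m : (forall p, 0 < w p) ->
  exists2 e, 0 < e & forall p, (p <= m)%N -> e <= w p.
Proof.
move=> w0; elim: m => [|m [e e0 He]].
  by exists (w 0%N) => // p; rewrite leqn0 => /eqP->.
exists (Num.min e (w m.+1)) => [|p]; first by rewrite lt_min e0 w0.
rewrite leq_eqVlt => /orP[/eqP->|]; first by rewrite ge_min lexx orbT.
by rewrite ltnS => /He ew; rewrite ge_min ew.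
Qed.

(* A jet with positive entries extends to an absolutely monotone function, whose
   Taylor coefficients grow at most geometrically. *)
Lemma positive_jet_not_approximable M (w : nat -> R) q : log_convex M ->
  bang_divergent M -> (forall p, 0 < w p) ->
  (forall D A : R, 0 <= D -> 0 < A -> exists p, D * A ^+ p < w p) ->
  ~ forall n, exists phi d, [/\ jet_tower M q phi, d < n.+1%:R^-1 &
      forall p, (p <= n)%N -> `|phi p 0 / p`!%:R - w p| <= d].
Proof.
move=> lcM divM w0 wbig approx.
have M0 p : 0 < M p by case: lcM.
have f0 p : 0 < p`!%:R :> R by rewrite ltr0n fact_gt0.
set Q : R := q.+1%:R; have Q0 : 0 < Q by rewrite ltr0n.
set L := fun p => Q ^+ p.+1 * M p.
have L0 p : 0 < L p by rewrite mulr_gt0 // exprn_gt0.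
(* At order [p0] the entry is too large for an absolutely monotone function bounded by [L 0] on
   [[0, Q^-1]]; the factor 2 allows for the approximation error. *)
have [p0 Hp0] := wbig (2 * L 0%N) Q (mulr_ge0 (ler0n _ _) (ltW (L0 _))) Q0.
have a0 : 0 <= Q^-1 by rewrite invr_ge0 ltW.
have v0 p : 0 < p`!%:R * (w p / 2) by rewrite mulr_gt0 // divr_gt0.
have [m Hm] := bang_positivity_upto p0.+1 a0 v0 (log_convex_geometric Q0 lcM)
                 (bang_divergent_geometric Q0 divM).
have [e e0 He] := finite_lower_bound (maxn m p0) w0.
(* Covers all orders up to [m] and [p0], with an error of at most half of each entry there. *)
set n := maxn (maxn m p0) (Num.trunc (2 / e)).
have [phi [d [[tow bnd] dn Hd]]] := approx n.
have de : d <= e / 2.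
  apply: le_trans (ltW dn) _; rewrite -[leRHS]invrK lef_pV2 ?posrE ?invr_gt0 ?divr_gt0 //.
  rewrite invf_div; apply: le_trans (ltW (truncnS_gt _)) _.
  by rewrite ler_nat ltnS leq_maxr.
have phi_ge p : (p <= maxn m p0)%N -> p`!%:R * (w p / 2) <= phi p 0.
  move=> pm; have H1 := He p pm.
  have := Hd p (leq_trans pm (leq_maxl _ _)); rewrite ler_norml => /andP[H2 _].
  by rewrite mulrC -ler_pdivlMr //; lra.
have pos := Hm phi tow bnd (fun p pm => phi_ge p (leq_trans pm (leq_maxl _ _))).
have := tower_taylor_le a0 tow (fun p t pp ta => ltW (pos p t pp ta)).
have aa : 0 <= Q^-1 <= Q^-1 by rewrite a0 lexx.
have := le_trans (ler_norm _) (bnd 0%N Q^-1 aa).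
rewrite -/Q -/(L 0%N) => H1 /le_trans/(_ H1) H2.
have H3 := phi_ge p0 (leq_maxr _ _).
move: Hp0; apply/negP; rewrite -leNgt.
have Qp0 : 0 < Q ^+ p0 by rewrite exprn_gt0.
move: H2; rewrite exprVn mulrAC ler_pdivrMr // => H2.
have : w p0 / 2 <= phi p0 0 / p0`!%:R by rewrite ler_pdivlMr // mulrC.
lra.
Qed.

End Bang.

(** * Lebesgue measure on a segment as a witness of Haar nullity *)

Section LineMeasure.
Variables (R : realType) (r : nat) (N : nat -> R).
Hypothesis N_gt0 : forall p, 0 < N p.
Implicit Types (b c x : mindex r -> R) (A B U : set (mindex r -> R)) (t : R).

Lemma normfact_gt0 p : 0 < normfact N p.
Proof. by rewrite divr_gt0 // ltr0n fact_gt0. Qed.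

Lemma LambdaB b c : Lambda N b -> Lambda N c -> Lambda N (fun a => b a - c a).
Proof.
move=> Lb Lc h h0; have [C HC] := Lb h h0; have [D HD] := Lc h h0.
exists (C + D) => a; rewrite mulrDl.
exact: le_trans (ler_normB _ _) (lerD (HC a) (HD a)).
Qed.

Lemma LambdaZ t c : Lambda N c -> Lambda N (fun a => t * c a).
Proof.
move=> Lc h h0; have [C HC] := Lc h h0.
by exists (`|t| * C) => a; rewrite normrM -mulrA ler_wpM2l.
Qed.

(** Finitely many orders are controlled by the single seminorm with [h = 1], each [n_p] with
    [p <= n] being at most the sum [S]. *)
Lemma Lopen_cylinder U : U `<=` Lambda N ->
  (forall b, U b -> exists n d, 0 < d /\ forall c, Lambda N c ->
     (forall a, (mlen a <= n)%N -> `|c a - b a| <= d) -> U c) ->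
  Lopen N U.
Proof.
move=> UL cyl; split=> // b /cyl [n [d [d0 Hd]]].
set S := \sum_(p < n.+1) normfact N p.
have S0 : 0 <= S by apply: sumr_ge0 => p _; exact/ltW/normfact_gt0.
have S1 : 0 < 1 + S by rewrite ltr_pwDl.
exists 1, (d / (1 + S)); split => //; split; first by rewrite divr_gt0.
move=> c [Lc Hc]; apply: Hd => // a an.
apply: le_trans (Hc a) _; rewrite expr1n mul1r mulrAC ler_pdivrMr //.
rewrite ler_pM2l // /S (bigD1 (inord (mlen a))) //= inordK //.
rewrite addrCA lerDl addr_ge0 //.
by apply: sumr_ge0 => p _; exact/ltW/normfact_gt0.
Qed.

Lemma Lborel_bigcap (F : nat -> set (mindex r -> R)) :
  (forall n, Lopen N (F n)) -> Lborel N (\bigcap_n F n).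
Proof.
move=> oF; have -> : \bigcap_n F n = Lambda N `\` \bigcup_n (Lambda N `\` F n).
  apply/seteqP; split=> [b Fb|b [Lb nFb] n _].
    by split=> [|[n _ [_]]]; [case: (oF 0%N) => + _; apply; apply: Fb|apply; apply: Fb].
  by apply: contrapT => nF; apply: nFb; exists n.
apply: sigma_algebraCD; apply: sigma_algebra_bigcup => n.
by apply: sigma_algebraCD; apply: sub_sigma_algebra.
Qed.

Definition line c t : mindex r -> R := fun a => t * c a.

Variable c : mindex r -> R.
Hypothesis Lc : Lambda N c.

Lemma open_preimage_line A : Lopen N A -> open (line c @^-1` A).
Proof.
move=> [_ oA]; rewrite openE => t /= /oA [h [e [h0 [e0 He]]]].
have [C HC] := Lc h0.
apply/nbhs_ballP; exists (e / (1 + `|C|)) => /=.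
  by rewrite divr_gt0 // ltr_pwDl.
move=> s; rewrite /ball /= => ts; apply: He; split; first exact: LambdaZ.
move=> a; rewrite /line -mulrBl normrM distrC.
have C1 : 0 < 1 + `|C| by rewrite ltr_pwDl.
set z := h ^+ _ * _; have z0 : 0 <= z.
  by rewrite mulr_ge0 ?exprn_ge0 // ltW // normfact_gt0.
have cz : `|c a| <= (1 + `|C|) * z.
  apply: le_trans (HC a) _; rewrite ler_wpM2r //.
  by apply: le_trans (ler_norm _) _; rewrite lerDr.
apply: le_trans (ler_pM _ _ (ltW ts) cz) _ => //.
by rewrite mulrA divfK // gt_eqF.
Qed.

Lemma measurable_preimage_line A : Lborel N A ->
  measurable (line c @^-1` A : set (measurableTypeR R)).
Proof.
move: A; apply: smallest_sub; last first.
  by move=> A /open_preimage_line; exact: measurable_realfun.open_measurable.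
split=> [|A mA|F mF] /=.
- by rewrite preimage_set0.
- have -> : line c @^-1` (Lambda N `\` A) = ~` (line c @^-1` A).
    apply/seteqP; split=> t /=; first by case.
    by move=> At; split=> //; exact: LambdaZ.
  exact: measurableC.
- by rewrite preimage_bigcup; apply: bigcupT_measurable.
Qed.

(** The image under [line c] of Lebesgue measure on [[0, 1]], made real-valued by [fine]. *)
Definition line_measure A : R :=
  fine (lebesgue_measure (`[0, 1] `&` line c @^-1` A : set R)).

Lemma lebesgue_measure01 : lebesgue_measure (`[0, 1] : set R) = 1%:E.
Proof. by rewrite lebesgue_measure_itv /= lte_fin ltr01 oppr0 addr0. Qed.

Lemma line_measure_fin A : Lborel N A ->
  lebesgue_measure (`[0, 1] `&` line c @^-1` A : set R) \is a fin_num.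
Proof.
move=> bA; rewrite ge0_fin_numE //.
apply: (@le_lt_trans _ _ (lebesgue_measure (`[0, 1] : set R))).
  apply: le_measure; rewrite ?inE; last by move=> t [].
    by apply: measurableI => //; exact: measurable_preimage_line.
  exact: measurable_itv.
by rewrite lebesgue_measure01 ltry.
Qed.

Lemma line_measure1 A : (`[0, 1] : set R) `<=` line c @^-1` A ->
  line_measure A = 1.
Proof. by move=> sub; rewrite /line_measure setIidl // lebesgue_measure01. Qed.

Lemma line_measure_Lprob : Lprob N line_measure.
Proof.
split; first by move=> A _; apply: fine_ge0.
split.
  by apply: line_measure1 => t _; exact: LambdaZ.
move=> F bF tF.
pose G n := `[0, 1] `&` line c @^-1` F n : set R.
have mG n : measurable (G n : set (measurableTypeR R)).
  by apply: measurableI => //; exact: measurable_preimage_line.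
have GE : \bigcup_n G n = `[0, 1] `&` line c @^-1` (\bigcup_n F n).
  by rewrite preimage_bigcup setI_bigcupr.
have bU : Lborel N (\bigcup_n F n) by exact: sigma_algebra_bigcup.
have tG : trivIset setT G.
  apply: trivIset_setIl => i j _ _ [t [Fi Fj]].
  by apply: tF => //; exists (line c t).
have : (fun n => \sum_(0 <= i < n) lebesgue_measure (G i))%E @ \oo -->
    (line_measure (\bigcup_n F n))%:E.
  rewrite /line_measure fineK; last exact: line_measure_fin.
  rewrite -GE; apply: (@measure_semi_sigma_additive _ _ _ (@lebesgue_measure R)) => //.
  exact: bigcup_measurable.
move=> /fine_cvg.
apply: cvg_trans; apply: near_eq_cvg; apply: nearW => n /=.
rewrite /series /= sum_fine // => i _; exact: line_measure_fin.
Qed.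

Lemma line_measure_subsingleton A :
  (forall s t, A (line c s) -> A (line c t) -> s = t) -> line_measure A = 0.
Proof.
move=> Ast; rewrite /line_measure.
have [[t [t01 At]]|nA] := pselect ((`[0, 1] `&` line c @^-1` A : set R) !=set0).
  suff -> : (`[0, 1] `&` line c @^-1` A : set R) = [set t].
    by rewrite lebesgue_measure_set1.
  by apply/seteqP; split=> [s [_ As]|s ->] //=; exact: Ast.
suff -> : (`[0, 1] `&` line c @^-1` A : set R) = set0 by rewrite measure0.
by apply/eqP; apply: contrapT => /negP/set0P.
Qed.

Definition segment_line := line c @` (`[0, 1] : set R).

Lemma Lcompact_segment_line : Lcompact N segment_line.
Proof.
split=> [_ [t _ <-]|F oF covF]; first exact: LambdaZ.
have := @segment_compact R 0 1; rewrite compact_cover.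
move=> /(_ _ F (fun A => line c @^-1` A)) [].
- by move=> A /oF; exact: open_preimage_line.
- by move=> t t01; have [A FA At] := covF _ (imageP (line c) t01); exists A.
move=> D DF cov; exists [set` D]; split; first exact: finite_fset.
split; first by move=> A /DF; rewrite inE.
by move=> _ [t /cov [A DA At] <-]; exists A.
Qed.

Lemma Lborel_segment_line a0 : c a0 = 1 -> Lborel N segment_line.
Proof.
move=> c1.
have -> : segment_line = Lambda N `\` (Lambda N `\` segment_line).
  by rewrite setDD setIidr // => _ [t _ <-]; exact: LambdaZ.
apply: sigma_algebraCD; apply: sub_sigma_algebra; apply: Lopen_cylinder.
  by move=> b [].
move=> b [Lb nKb].
(* [b a0] is the only candidate parameter, so one further coordinate
   separates [b] from the segment. *)
suff [a [d [d0 Hd]]] : exists a d, 0 < d /\ forall t, 0 <= t <= 1 ->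
    `|t - b a0| <= d -> d < `|t * c a - b a|.
  exists (maxn (mlen a0) (mlen a)), d; split=> // b' Lb' Hb'; split=> // -[t].
  rewrite /= in_itv /= => t01 tb'; subst b'.
  have := Hb' a0 (leq_maxl _ _); rewrite /line c1 mulr1 => /(Hd t t01).
  by rewrite ltNge => /negP; apply; apply: Hb'; apply: leq_maxr.
(* Outside [[0, 1]] the coordinate [a0] itself separates, with half the distance to the interval. *)
have [b01|nb01] := boolP (0 <= b a0 <= 1); last first.
  exists a0; rewrite c1; have [b0|b0] := ltP (b a0) 0.
    exists (- b a0 / 2); split; first lra.
    by move=> t t01; rewrite mulr1 ger0_norm; lra.
  have b1 : 1 < b a0 by rewrite b0 /= -ltNge in nb01.
  exists ((b a0 - 1) / 2); split; first lra.
  by move=> t t01; rewrite mulr1 ler0_norm; lra.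
have [a ba] : exists a, b a0 * c a != b a.
  apply: contrapT => H; apply: nKb; exists (b a0); first by rewrite /= in_itv.
  apply/funext => a; apply/eqP; apply: contrapT => /negP ba; apply: H.
  by exists a.
set g := `|b a0 * c a - b a|.
have g0 : 0 < g by rewrite normr_gt0 subr_eq0.
have k0 : 0 < 2 + `|c a| by rewrite ltr_pwDl.
(* Moving the parameter by [d] costs at most [d * |c a|] of the gap [g], which leaves [2 * d]. *)
exists a, (g / (2 + `|c a|)); split; first by rewrite divr_gt0.
move=> t _ td; set d := g / _ in td *.
have gE : g = d * 2 + d * `|c a| by rewrite -mulrDr divfK // gt_eqF.
have d0 : 0 < d by rewrite divr_gt0.
have : g <= `|t * c a - b a| + `|t - b a0| * `|c a|.
  rewrite -normrM; apply: le_trans (ler_normB _ _).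
  by rewrite /g; rewrite le_eqVlt; apply/orP; left; apply/eqP; congr `|_|; ring.
have := ler_wpM2r (normr_ge0 (c a)) td.
lra.
Qed.

Lemma Lhaar_null_transverse a0 A B : c a0 = 1 -> Lborel N B -> A `<=` B ->
  (forall x s t, Lambda N x -> translate x B (line c s) ->
     translate x B (line c t) -> s = t) ->
  Lhaar_null N A.
Proof.
move=> c1 bB AB transv; exists B; split=> //; split=> //.
exists line_measure; split; first exact: line_measure_Lprob.
split; last first.
  by move=> x Lx; apply: line_measure_subsingleton => s t; exact: transv.
exists segment_line; split; first exact: Lcompact_segment_line.
split; first exact: (@Lborel_segment_line a0).
by apply: line_measure1 => t t01; exists t.
Qed.

End LineMeasure.

(** * Restriction of a Roumieu function to a coordinate axis *)

Section AxisRestriction.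
Variables (R : realType) (r : nat) (i0 : 'I_r).
Implicit Types (f : 'rV[R]_r -> R) (M : nat -> R).

Definition axis_index (p : nat) : mindex r := [ffun i => if i == i0 then p else 0%N].

Lemma mlen_axis_index p : mlen (axis_index p) = p.
Proof.
rewrite /mlen (bigD1 i0) //= ffunE eqxx big1 ?addn0 // => i /negbTE ne.
by rewrite ffunE ne.
Qed.

Lemma pderiv_axis_index p f : pderiv (axis_index p) f = pderiv_seq (nseq p i0) f.
Proof.
rewrite /pderiv; congr pderiv_seq.
have : i0 \in enum 'I_r by rewrite mem_enum.
have : uniq (enum 'I_r) by exact: enum_uniq.
elim: (enum 'I_r) => // i s IH /=; rewrite inE ffunE (eq_sym i) => /andP[nis us].
have [ii _|_ /=] := eqVneq i0 i; last by move=> /IH ->.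
subst i.
rewrite -[RHS]cats0; congr cat.
elim: s nis {IH us} => //= j s IH; rewrite inE negb_or => /andP[ij nis].
by rewrite IH // cats0 ffunE [j == _]eq_sym (negbTE ij).
Qed.

Lemma is_derive_axis (g : 'rV[R]_r -> R) (v : 'rV[R]_r) (t : R) :
  derivable g (t *: v) v ->
  is_derive t 1 (fun s : R => g (s *: v)) (derive g (t *: v) v).
Proof.
have E : (fun h : R => h^-1 *: (((fun s : R => g (s *: v)) \o shift t) (h *: (1 : R)) - g (t *: v)))
   = (fun h : R => h^-1 *: ((g \o shift (t *: v)) (h *: v) - g (t *: v))).
  by apply/funext => h /=; rewrite scalerDl [h *: 1]mulr1.
by move=> dg; apply: DeriveDef; rewrite /derivable /derive E.
Qed.

Lemma jet_tower_of_roumieu M k f : (forall p, 0 < M p) -> (0 < k)%N ->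
  roumieu M (@cube R r k) f ->
  exists q, jet_tower M q (fun p t => pderiv (axis_index p) f (t *: evec R i0)).
Proof.
move=> M0 k0 [smf bndf].
set e := evec R i0.
(* The cube is open, hence the closed segment stops at [1 / (k + 1)]. *)
have sub (t : R) : 0 <= t <= k.+1%:R^-1 -> cube k (t *: e).
  move=> /andP[t0 tk] i; rewrite !mxE eqxx /= normrM ger0_norm //.
  apply: (@le_lt_trans _ _ k.+1%:R^-1).
    apply: le_trans tk; rewrite ler_piMr //.
    by case: (i == i0); rewrite ?normr1 ?normr0 ?ler01.
  by rewrite ltf_pV2 ?posrE ?ltr0n // ltr_nat.
set K := (fun t : R => t *: e) @` (`[0, k.+1%:R^-1] : set R).
have cK : compact K.
  apply: continuous_compact; last exact: segment_compact.
  by apply: continuous_subspaceT => t; apply: scalel_continuous.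
have KU : K `<=` cube k.
  by move=> _ [t + <-]; rewrite /= in_itv; exact: sub.
have [h [h0 [C HC]]] := bndf K cK KU.
(* Then [q + 1] dominates [k + 1], [h] and [C]; the factor for [C] accounts for the exponent [l.+1]
   in [jet_tower]. *)
pose q := (k + Num.trunc h + Num.trunc C)%N.
have Qh : h <= q.+1%:R.
  apply: le_trans (ltW (truncnS_gt _)) _.
  by rewrite ler_nat ltnS /q addnAC leq_addl.
have QC : C <= q.+1%:R.
  by apply: le_trans (ltW (truncnS_gt _)) _; rewrite ler_nat ltnS leq_addl.
have small (t : R) : 0 <= t <= q.+1%:R^-1 -> 0 <= t <= k.+1%:R^-1.
  move=> /andP[-> /le_trans]; apply.
  by rewrite lef_pV2 ?posrE ?ltr0n // ler_nat ltnS /q -addnA leq_addr.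
exists q; split=> [p t|l t] /small tk.
  rewrite !pderiv_axis_index; apply: is_derive_axis.
  by have [_] := smf (nseq p i0) _ (sub t tk); apply.
have Kt : K (t *: e) by exists t; rewrite //= in_itv.
apply: le_trans (HC _ _ Kt) _; rewrite mlen_axis_index exprS -mulrA.
apply: (@le_trans _ _ (q.+1%:R * (h ^+ l * M l))).
  by rewrite ler_wpM2r // mulr_ge0 ?exprn_ge0 // ltW.
rewrite ler_pM2l // ler_pM2r // lerXn2r ?nnegrE // ltW //.
Qed.

End AxisRestriction.

(** * A Borel set of approximable jets, closed under differences *)

Section JetClosure.
Variables (R : realType) (r : nat) (i0 : 'I_r) (M N : nat -> R).
Hypothesis (M_gt0 : forall p, 0 < M p) (N_gt0 : forall p, 0 < N p).
Implicit Types (b c x : mindex r -> R).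

(** The tower may vary with [n] while its bound [q] may not. The strict inequality on [d] makes the
    set open. *)
Definition approx_jets (q n : nat) : set (mindex r -> R) :=
  [set b | Lambda N b /\ exists phi d, [/\ jet_tower M q phi, d < n.+1%:R^-1 &
     forall p, (p <= n)%N -> `|phi p 0 / p`!%:R - b (axis_index i0 p)| <= d]].

(* A Borel superset of the jets: the actual set of jets is Borel as well, but
   this would need the Arzela-Ascoli theorem. *)
Definition jet_closure := \bigcup_q \bigcap_n approx_jets q n.

Lemma Lopen_approx_jets q n : Lopen N (approx_jets q n).
Proof.
apply: Lopen_cylinder => // [b []//|b]; rewrite /approx_jets.
move: n.+1%:R^-1 => v [Lb [phi [d [tow dn Hd]]]].
exists n, ((v - d) / 2); split; first by rewrite divr_gt0 // subr_gt0.
move=> c Lc Hc; split=> //; exists phi, ((v + d) / 2); split=> //.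
  by lra.
move=> p pn; have := Hc (axis_index i0 p); rewrite mlen_axis_index => /(_ pn).
have := Hd p pn; rewrite !ler_norml; lra.
Qed.

Lemma Lborel_jet_closure : Lborel N jet_closure.
Proof.
apply: sigma_algebra_bigcup => q; apply: Lborel_bigcap => n.
exact: Lopen_approx_jets.
Qed.

Lemma jets_sub_jet_closure : jets_roumieu M `&` Lambda N `<=` jet_closure.
Proof.
move=> b [[k [k0 [f [Rf bE]]]] Lb].
have [q tow] := jet_tower_of_roumieu i0 M_gt0 k0 Rf.
exists q => // n _; split=> //; eexists; exists 0; split; [exact: tow|by rewrite invr_gt0|].
move=> p _; rewrite bE /borel_map mlen_axis_index scale0r subrr normr0 //.
Qed.

Lemma jet_closureB b c : jet_closure b -> jet_closure c ->
  jet_closure (fun a => b a - c a).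
Proof.
move=> [q1 _ H1] [q2 _ H2]; exists (q1 + q2).+1 => // n _.
(* Order [2n + 1] gives errors below [1 / (2n + 2)], and two of these add up to less than
   [1 / (n + 1)]. *)
have [Lb [phi [d [tow dn Hd]]]] := H1 (n + n.+1)%N I.
have [Lc [psi [e [tow' en He]]]] := H2 (n + n.+1)%N I.
split; first exact: LambdaB.
exists (fun l t => phi l t - psi l t), (d + e); split.
- exact: jet_towerB.
- have E : (n + n.+1).+1%:R^-1 = n.+1%:R^-1 / 2 :> R.
    by rewrite -addSn addnn -muln2 natrM invfM.
  by move: dn en; rewrite E; move: n.+1%:R^-1 => v; lra.
- move=> p pn; have pn' : (p <= n + n.+1)%N by rewrite (leq_trans pn) // leq_addr.
  have := Hd p pn'; have := He p pn'; rewrite mulrBl !ler_norml; lra.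
Qed.

Lemma jet_closure_not_positive (w : nat -> R) b : log_convex M ->
  bang_divergent M -> (forall p, 0 < w p) ->
  (forall D A : R, 0 <= D -> 0 < A -> exists p, D * A ^+ p < w p) ->
  (forall p, b (axis_index i0 p) = w p) -> ~ jet_closure b.
Proof.
move=> lcM divM w0 wbig bw [q _ H].
apply: (@positive_jet_not_approximable R M w q) => // n.
have [_ [phi [d [tow dn Hd]]]] := H n I.
by exists phi, d; split=> // p pn; rewrite -bw; exact: Hd.
Qed.

End JetClosure.

(** * Growth of the square roots of [n_p] *)

Section SquareRootJet.
Variables (R : realType) (nn : nat -> R).
Hypothesis (nn_gt0 : forall p, 0 < nn p).
Hypothesis (nn_cvg : (fun k => nn k `^ (k%:R^-1)) @ \oo --> +oo).

Lemma root_cvg_ge (A : R) : 0 <= A ->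
  exists2 K, (0 < K)%N & forall k, (K <= k)%N -> A ^+ k <= nn k.
Proof.
move=> A0; move/cvgryPge : nn_cvg => /(_ A)[K _ HK].
exists K.+1 => // k Kk; have k0 : (0 < k)%N by exact: leq_ltn_trans Kk.
have /= Ak := HK k (ltnW Kk).
have -> : nn k = (nn k `^ k%:R^-1) ^+ k.
  rewrite -powR_mulrn ?powR_ge0 // -powRrM mulVf ?powRr1 ?ltW //.
  by rewrite pnatr_eq0 -lt0n.
by rewrite lerXn2r ?nnegrE ?powR_ge0.
Qed.

Lemma sqrt_superexponential (D A : R) : 0 <= D -> 0 < A ->
  exists p, D * A ^+ p < Num.sqrt (nn p).
Proof.
move=> D0 A0; have D1 : 1 <= D + 1 by rewrite lerDr.
have B0 : 0 <= (D + 1) * A by rewrite mulr_ge0 ?(ltW A0) ?addr_ge0.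
(* The square compensates the root, and [K > 0] gives [D < (D + 1) ^+ K]. *)
have [K K0 HK] := root_cvg_ge (exprn_ge0 2 B0).
exists K; apply: (@lt_le_trans _ _ (((D + 1) * A) ^+ K)).
  rewrite exprMn ltr_pM2r ?exprn_gt0 //.
  apply: (@lt_le_trans _ _ (D + 1)); first by rewrite ltrDl.
  by rewrite -{1}[D + 1]expr1 ler_weXn2l.
rewrite -(@ler_pXn2r _ 2) ?nnegrE ?exprn_ge0 ?sqrtr_ge0 //.
by rewrite sqr_sqrtr ?(ltW (nn_gt0 _)) // exprAC; exact: HK.
Qed.

Lemma sqrt_infraexponential (h : R) : 0 < h ->
  exists C : R, forall k, Num.sqrt (nn k) <= C * (h ^+ k * nn k).
Proof.
move=> h0.
have hV0 : 0 <= (h^-1) ^+ 2 by rewrite exprn_ge0 // invr_ge0 ltW.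
have [K K0 HK] := root_cvg_ge hV0.
have hn k : 0 < h ^+ k * nn k by rewrite mulr_gt0 // exprn_gt0.
have F0 k : 0 <= Num.sqrt (nn k) / (h ^+ k * nn k).
  by rewrite divr_ge0 ?sqrtr_ge0 // ltW.
(* The sum covers the orders below [K]; from [K] on, [h^-1 ^+ k <= Num.sqrt (nn k)] and the constant
   1 suffices. *)
exists (1 + \sum_(k < K) Num.sqrt (nn k) / (h ^+ k * nn k)) => k.
rewrite -ler_pdivrMr //; have [kK|Kk] := ltnP k K.
  rewrite (bigD1 (Ordinal kK)) //= addrCA lerDl addr_ge0 //.
  by apply: sumr_ge0.
apply: (@le_trans _ _ 1); last by rewrite lerDl; apply: sumr_ge0.
rewrite ler_pdivrMr // mul1r.
have s0 : 0 < Num.sqrt (nn k) by rewrite sqrtr_gt0.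
have {2}-> : nn k = Num.sqrt (nn k) ^+ 2 by rewrite sqr_sqrtr // ltW.
rewrite expr2 mulrA ler_peMl ?(ltW s0) // -ler_pdivrMl ?exprn_gt0 // mulr1.
rewrite -(@ler_pXn2r _ 2) ?nnegrE ?invr_ge0 ?exprn_ge0 ?(ltW h0) ?sqrtr_ge0 //.
by rewrite sqr_sqrtr ?(ltW (nn_gt0 _)) // -exprVn exprAC; exact: HK.
Qed.

End SquareRootJet.

(** * Transversality of the square-root jet to the jets *)

Theorem mainTheorem5 (R : realType) (r : nat) (M N : nat -> R) :
  (0 < r)%N ->
  weight_sequence M -> quasianalytic M ->
  weight_sequence N -> quasianalytic N ->
  (fun k => normfact N k `^ (k%:R^-1)) @ \oo --> +oo ->
  @Lhaar_null R r N (@jets_roumieu R r M `&` @Lambda R r N).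
Proof.
move=> r0 [M0 [_ [_ [Mc _]]]] qM [N0 [N1 _]] _ nN.
pose i0 := Ordinal r0.
have lcM : log_convex M by split=> // p; exact: (Mc p.+1).
have n0 := normfact_gt0 N0.
pose c : mindex r -> R := fun a => Num.sqrt (normfact N (mlen a)).
have Lc : Lambda N c.
  move=> h h0; have [C HC] := sqrt_infraexponential n0 nN h0.
  by exists C => a; rewrite ger0_norm ?sqrtr_ge0 //; exact: HC.
have c1 : c (axis_index i0 0) = 1.
  by rewrite /c mlen_axis_index /normfact N1 fact0 divr1 sqrtr1.
apply: (Lhaar_null_transverse N0 Lc c1 (Lborel_jet_closure i0 M N0)
          (@jets_sub_jet_closure _ _ i0 _ _ M0)).
(* By symmetry [s < t] may be assumed, which makes the multiple [(t - s) c] positive. *)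
suff lt_case x s t : translate x (jet_closure i0 M N) (line c s) ->
    translate x (jet_closure i0 M N) (line c t) -> ~ s < t.
  move=> x s t _ Hs Ht; apply/eqP; rewrite eq_le !leNgt.
  by apply/andP; split; apply/negP; [exact: lt_case Ht Hs|exact: lt_case Hs Ht].
move=> [b Bb bE] [b' Bb' bE'] st.
(* From [x + b = s c] and [x + b' = t c], the translation cancels and [b' - b] is [(t - s) c]. *)
have := jet_closureB M0 Bb' Bb.
apply: (@jet_closure_not_positive _ _ _ _ _
          (fun p => (t - s) * Num.sqrt (normfact N p))) => //.
- exact: quasianalytic_bang_divergent.
- by move=> p; rewrite mulr_gt0 ?subr_gt0 ?sqrtr_gt0.
- move=> D A D0 A0; have ts : 0 < t - s by rewrite subr_gt0.
  have [p Hp] := sqrt_superexponential n0 nN (divr_ge0 D0 (ltW ts)) A0.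
  by exists p; rewrite -ltr_pdivrMl // mulrA [_^-1 * _]mulrC.
- move=> p; have := congr1 (@^~ (axis_index i0 p)) bE.
  have := congr1 (@^~ (axis_index i0 p)) bE'.
  rewrite /= /line /c mlen_axis_index mulrBl => <- <-; ring.
Qed.
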